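(* Let $(S_0,S_1,\dots)$ be a supermartingale relative to a nondecreasing sequence of $\sigma$-algebras $H_{\le 0}\subseteq H_{\le 1}\subseteq\cdots$, with $S_0\le 0$ a.s. and differences $X_i:=S_i-S_{i-1}$, $i=1,2,\dots$. Suppose that for every $i=1,2,\dots$ there exist non-random constants $d_i>0$ and $\sigma_i>0$ such that $X_i\le d_i$ and $\operatorname{Var}(X_i\mid H_{\le i-1})\le\sigma_i^2$ a.s. Then for all $n=1,2,\dots$, $$\mathbf{E}f(S_n)\le\mathbf{E}f(T_n)\quad\text{for all } f\in\mathcal{F}_+^{(2)},$$ where $T_n:=Z_1+\dots+Z_n$ and $Z_1,\dots,Z_n$ are independent random variables with $\mathbf{P}(Z_i=d_i)=\frac{\sigma_i^2}{d_i^2+\sigma_i^2}$ and $\mathbf{P}(Z_i=-\sigma_i^2/d_i)=\frac{d_i^2}{d_i^2+\sigma_i^2}$ (so that $\mathbf{E}Z_i=0$ and $\operatorname{Var}Z_i=\sigma_i^2$).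
   Context: $\mathcal{F}_+^{(2)}$ denotes the class of all functions $f:\mathbb{R}\to\mathbb{R}$ of the form $f(u)=\int_{-\infty}^{\infty}(u-t)_+^2\,\mu(dt)$ for all $u\in\mathbb{R}$, for some Borel measure $\mu\ge0$ on $\mathbb{R}$, where $x_+:=\max(0,x)$. *)

(* Defs.v *)
From HB Require Import structures.
From mathcomp Require Import all_boot all_order all_algebra.
From mathcomp Require Import all_classical all_reals all_analysis measurable_realfun.
Set Implicit Arguments. Unset Strict Implicit. Unset Printing Implicit Defensive.
Import Order.TTheory GRing.Theory Num.Theory.
Local Open Scope classical_set_scope.
Local Open Scope ring_scope.
Local Open Scope ereal_scope.

Section defs.
Context {R : realType}.

Definition pos_part (x : R) : R := Num.max 0%R x.

(* The class F_+^(2): f(u) = \int (u-t)_+^2 mu(dt) for a Borel measure mu >= 0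
   on R (the integral being finite since f is real-valued). *)
Definition F2plus (f : R -> R) : Prop :=
  exists mu : {measure set R -> \bar R},
    forall u : R, (f u)%:E = \int[mu]_t ((pos_part (u - t)) ^+ 2)%:E.

Context {d : measure_display} {T : measurableType d}.

Definition sub_sigma (G : set (set T)) : Prop :=
  sigma_algebra setT G /\ G `<=` measurable.

Definition Gmeas (G : set (set T)) (Y : T -> R) : Prop :=
  forall B : set R, measurable B -> G (Y @^-1` B).
Definition Gmeas_e (G : set (set T)) (Y : T -> \bar R) : Prop :=
  forall B : set (\bar R), measurable B -> G (Y @^-1` B).

Variable P : probability T R.

Definition is_cond_exp (G : set (set T)) (X Y : T -> R) : Prop :=
  Gmeas G Y /\ P.-integrable setT (EFin \o Y) /\
  forall A, G A -> \int[P]_(x in A) (Y x)%:E = \int[P]_(x in A) (X x)%:E.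

Definition is_cond_exp_nneg (G : set (set T)) (W V : T -> \bar R) : Prop :=
  Gmeas_e G V /\ (forall x, 0 <= V x) /\
  forall A, G A -> \int[P]_(x in A) V x = \int[P]_(x in A) W x.

Definition cond_var_le (G : set (set T)) (X : T -> R) (s2 : R) : Prop :=
  exists M : T -> R, is_cond_exp G X M /\
  exists V : T -> \bar R,
    is_cond_exp_nneg G (fun x => (((X x - M x) ^+ 2)%R)%:E) V /\
    {ae P, forall x, V x <= s2%:E}.

Definition filtration (H : nat -> set (set T)) : Prop :=
  (forall i, sub_sigma (H i)) /\ (forall i, H i `<=` H i.+1).

Definition supermartingale (H : nat -> set (set T)) (S : nat -> T -> R) : Prop :=
  filtration H /\
  (forall i, Gmeas (H i) (S i)) /\
  (forall i, P.-integrable setT (EFin \o S i)) /\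
  (forall i, exists Y : T -> R, is_cond_exp (H i) (S i.+1) Y /\
     {ae P, forall x, (Y x <= S i x)%R}).

End defs.

Definition indep_family {R : realType} {d : measure_display} {T : measurableType d}
  (Q : probability T R) (n : nat) (Z : nat -> T -> R) : Prop :=
  forall B : nat -> set R, (forall i, measurable (B i)) ->
    Q (\bigcap_(i in [set i | (1 <= i <= n)%N]) (Z i @^-1` B i)) =
    \prod_(1 <= i < n.+1) Q (Z i @^-1` B i).

(* Main.v *)
Require Import Defs.
From HB Require Import structures.
From mathcomp Require Import all_boot all_order all_algebra.
From mathcomp Require Import all_classical all_reals all_analysis measurable_realfun.
From mathcomp Require Import ring lra.
Import Order.TTheory GRing.Theory Num.Theory.
Local Open Scope classical_set_scope.
Local Open Scope ring_scope.
Set Implicit Arguments. Unset Strict Implicit. Unset Printing Implicit Defensive.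

(** By Tonelli it suffices to treat [f u = (u - t)_+^2], and by induction on [n]
    one conditional step. Given [H_{i-1}], write [X_i = U + M] with
    [M = E(X_i | H_{i-1}) <= 0]; on [U + M <= d_i] the function
    [(U + M - w)_+^2] is dominated by a parabola [a (U + c)^2] with
    [H_{i-1}]-measurable [0 <= a <= 1] and [c >= 0], whose conditional mean is at
    most [a (sigma_i^2 + c^2)], and this does not exceed [E (Z_i - w)_+^2], even
    though the variance bound is about [M] and not about [0]. On the side of the
    [Z_i] only a lower bound is needed: the [2^n] joint atoms of [Z_1, ..., Z_n]
    already carry the value of the iterated two-point average of [f] at [0]. *)

(** * Dominating a truncated square by a parabola, and the extremal two-point value *)

Section dominating_quadratic.
Context {R : realFieldType}.
Implicit Types d v M w u : R.

Definition sqpos (x : R) : R := (Num.max 0 x) ^+ 2.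

Lemma sqpos_le x y : 0 <= y -> x <= y -> sqpos x <= y ^+ 2.
Proof.
by move=> y0 xy; rewrite /sqpos lerXn2r// ?nnegrE ?le_max ?lexx// ge_max y0.
Qed.

Lemma sqpos_ge0 x : 0 <= sqpos x. Proof. exact: sqr_ge0. Qed.

Lemma sqpos_pos x : 0 <= x -> sqpos x = x ^+ 2.
Proof. by move=> x0; rewrite /sqpos max_r. Qed.

Lemma sqpos_neg x : x <= 0 -> sqpos x = 0.
Proof. by move=> x0; rewrite /sqpos max_l// expr0n. Qed.

(* On [u <= d - M] the function [sqpos (u + M - w)] lies below the parabola
   [a (u + c)^2] that agrees with it at [u = d - M] and vanishes at
   [u = - v / (d - M)], the lower atom of the extremal centred law; when that
   parabola would be steeper than [(u + M - w)^2], the latter is used instead. *)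
Definition qcoef d v M w : R :=
  (Num.min 1 (Num.max 0 (d - w) * ((d - M) / ((d - M) ^+ 2 + v)))) ^+ 2.

Definition qshift d v M w : R := Num.max (v / (d - M)) (M - w).

Lemma qcoef_01 d v M w :
  0 < d -> 0 < v -> M <= 0 -> 0 <= qcoef d v M w <= 1.
Proof.
move=> d0 s0 M0; rewrite /qcoef sqr_ge0/= expr_le1// ?ge_min ?lexx//.
rewrite le_min ler01 mulr_ge0 ?le_max ?lexx// divr_ge0 ?addr_ge0 ?sqr_ge0//; nra.
Qed.

(** With [e = d - M] we have [d - w = e + (M - w)], so [(d - w) * e <= e ^+ 2 + v] iff
    [(M - w) * e <= v]: one comparison decides both the [min] in [qcoef] and the [max] in [qshift].
    In the flat case the parabola is the square of an affine function that meets [u + M - w] at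
    [u = e] with slope at most 1, hence lies above it for [u <= e]. *)
Lemma quad_dominates d v M w u : 0 < d -> 0 < v -> M <= 0 -> u + M <= d ->
  sqpos (u + M - w) <= qcoef d v M w * (u + qshift d v M w) ^+ 2.
Proof.
move=> d0 s0 M0 ud; rewrite /qcoef /qshift.
have [wd|dw] := leP d w.
  have h : u + M - w <= 0 by lra.
  by rewrite sqpos_neg//; apply: mulr_ge0; exact: sqr_ge0.
have e0 : 0 < d - M by lra.
set e := d - M in e0 *.
have q0 : 0 < e ^+ 2 + v by nra.
have -> : Num.max 0 (d - w) = d - w by rewrite max_r//; lra.
have [h|h] := leP (v / e) (M - w).
  rewrite min_l; last by
    rewrite mulrA ler_pdivlMr// mul1r; move: h; rewrite ler_pdivrMr// /e; nra.
  rewrite expr1n mul1r addrA /sqpos.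
  by case: (leP 0 (u + M - w)) => _ //; rewrite expr0n sqr_ge0.
move: h; rewrite ltr_pdivlMr// => h.
rewrite min_r; last by
    rewrite mulrA ler_pdivrMr// mul1r; move: h; rewrite /e; nra.
have -> : ((d - w) * (e / (e ^+ 2 + v))) ^+ 2 * (u + v / e) ^+ 2 =
   ((d - w) * (e * u + v) / (e ^+ 2 + v)) ^+ 2.
  by field; rewrite !gt_eqF.
have [x0|x0] := leP (u + M - w) 0; first by rewrite sqpos_neg ?sqr_ge0.
have : u + M - w <= (d - w) * (e * u + v) / (e ^+ 2 + v).
  by rewrite ler_pdivlMr//; rewrite /e in h q0 e0 *; nra.
by move=> h2; apply: sqpos_le => //; apply: le_trans h2; apply: ltW.
Qed.

(** In the flat case the left side is [v / (e ^+ 2 + v) * (d - w) ^+ 2] with [e = d - M >= d], so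
    the upper atom alone dominates it. In the steep case it is [v + (M - w) ^+ 2] with
    [0 < M - w <= - w], and the position of the lower atom relative to [w] matters. *)
Lemma quad_value d v M w : 0 < d -> 0 < v -> M <= 0 ->
  qcoef d v M w * (v + qshift d v M w ^+ 2) <=
  v / (d ^+ 2 + v) * sqpos (d - w) +
  d ^+ 2 / (d ^+ 2 + v) * sqpos (- (v / d) - w).
Proof.
move=> d0 s0 M0; rewrite /qcoef /qshift.
have p0 : 0 < d ^+ 2 + v by nra.
have [wd|dw] := leP d w.
  rewrite max_l ?mul0r ?min_r// ?expr0n ?mul0r; last by lra.
  by rewrite addr_ge0// mulr_ge0 ?sqpos_ge0// divr_ge0 ?sqr_ge0 ?ltW.
rewrite (@sqpos_pos (d - w)); last lra.
have e0 : 0 < d - M by lra.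
set e := d - M in e0 *.
have q0 : 0 < e ^+ 2 + v by nra.
have -> : Num.max 0 (d - w) = d - w by rewrite max_r//; lra.
have RH : 0 <= d ^+ 2 / (d ^+ 2 + v) * sqpos (- (v / d) - w).
  by rewrite mulr_ge0 ?sqpos_ge0// divr_ge0 ?sqr_ge0 ?ltW.
have [h|h] := leP (v / e) (M - w).
  rewrite min_l; last by
    rewrite mulrA ler_pdivlMr// mul1r; move: h; rewrite ler_pdivrMr// /e; nra.
  rewrite expr1n mul1r.
  (* If the lower atom contributes nothing, expand [(d - w) ^+ 2 = (e + (M - w)) ^+ 2] and compare
     term by term, using [e >= d], [(M - w) * d <= v] and [v <= (M - w) * e]. If it contributes,
     both truncations are inactive and the right side is the full second moment [v + w ^+ 2]. *)
  have [h2|h2] := leP (- (v / d) - w) 0.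
    rewrite sqpos_neg// mulr0 addr0 mulrAC ler_pdivlMr//.
    have : - w * d <= v by rewrite -ler_pdivlMr//; lra.
    move: h; rewrite ler_pdivrMr// => h h3.
    have m0 : 0 < M - w by rewrite /e in h; nra.
    have md : ((M - w) * d) ^+ 2 <= v ^+ 2 by rewrite lerXn2r ?nnegrE; nra.
    have ed : d ^+ 2 * v <= e ^+ 2 * v by rewrite ler_pM2r// /e; nra.
    have em : v * v <= (M - w) * e * v by rewrite ler_pM2r.
    have -> : d - w = e + (M - w) by rewrite /e; ring.
    nra.
  rewrite sqpos_pos; last exact: ltW.
  have -> : v / (d ^+ 2 + v) * (d - w) ^+ 2 +
    d ^+ 2 / (d ^+ 2 + v) * (- (v / d) - w) ^+ 2 = v + w ^+ 2.
    by field; rewrite !gt_eqF.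
  have : 0 < v / e by rewrite divr_gt0.
  nra.
move: h; rewrite ltr_pdivlMr// => h.
rewrite min_r; last by
    rewrite mulrA ler_pdivrMr// mul1r; move: h; rewrite /e; nra.
have -> : ((d - w) * (e / (e ^+ 2 + v))) ^+ 2 * (v + (v / e) ^+ 2) =
   v / (e ^+ 2 + v) * (d - w) ^+ 2.
  by field; rewrite !gt_eqF.
rewrite -[leLHS]addr0 lerD// ler_wpM2r ?sqr_ge0// ler_pM2l// lef_pV2 ?posrE//.
by rewrite lerD2r /e; nra.
Qed.
End dominating_quadratic.

(** * Measurability and integration relative to a sub-sigma-algebra *)

Section sub_sigma_algebra.
Context {R : realType} {d : measure_display} {T : measurableType d}.
Variable P : probability T R.
Variable G : set (set T).
Hypothesis sG : sub_sigma G.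
Local Notation TG := (g_sigma_algebraType G).

Lemma measurable_sub_sigma : @measurable _ TG = G.
Proof. exact: (sigma_algebra_id (proj1 sG)). Qed.

(** Gives [Gmeas] access to the closure properties of [measurable_fun]. *)
Lemma GmeasP (Y : T -> R) : Gmeas G Y <-> measurable_fun [set: TG] (Y : TG -> R).
Proof.
have GE := measurable_sub_sigma.
split=> [h _ B mB|h B mB]; first by rewrite setTI GE; exact: h.
by have := h measurableT B mB; rewrite setTI GE.
Qed.

Lemma Gmeas_measurable (Y : T -> R) : Gmeas G Y -> measurable_fun setT Y.
Proof. by move=> h _ B mB; rewrite setTI; exact/(proj2 sG)/h. Qed.

Lemma integrable_bounded_mul (b h : T -> R) (K : R) :
  measurable_fun setT b -> (forall x, `|b x| <= K) ->
  P.-integrable setT (EFin \o h) -> P.-integrable setT (EFin \o (fun x => b x * h x)).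
Proof.
move=> mb bK ih.
have mh : measurable_fun setT h by apply/measurable_EFinP; case/integrableP : ih.
apply: (@le_integrable _ _ _ P _ measurableT _ (EFin \o (fun x => K * h x))).
- by apply/measurable_EFinP; exact: measurable_funM.
- move=> x _ /=; rewrite lee_fin !normrM ler_wpM2r//.
  by apply: le_trans (bK x) _; exact: ler_norm.
- rewrite (_ : EFin \o _ = (fun x => K%:E * (h x)%:E)%E) //.
  exact: integrableZl.
Qed.

(** Stands in for taking a [G]-measurable factor out of a conditional expectation: an inequality
    tested on the sets of [G] is extended to weights with values in [0, 1]. *)
Lemma integral_Gmeas_mul_le0 (h b : T -> R) :
  P.-integrable setT (EFin \o h) ->
  (forall A, G A -> (\int[P]_(x in A) (h x) <= 0)) ->
  Gmeas G b -> (forall x, 0 <= b x <= 1) ->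
  \int[P]_x (b x * h x) <= 0.
Proof.
move=> ih hA.
(* Halving: [2 c = 1_{c >= 1/2} + c'] with [0 <= c' <= 1] again, so the bound
   [\int |h|] gains a factor 1/2 at each step. *)
suff H n c : Gmeas G c -> (forall x, 0 <= c x <= 1) ->
    \int[P]_x (c x * h x) <= 2 ^- n * \int[P]_x `|h x|.
  move=> mb b01.
  have [//|I0] := leP (\int[P]_x (b x * h x)) 0.
  have J0 : 0 < \int[P]_x `|h x|.
    by apply: lt_le_trans I0 _; have := H 0 _ mb b01; rewrite expr0 invr1 mul1r.
  (* A [k] with [1 / (k + 1)] below the ratio of the two integrals suffices, since [k < 2 ^ k] gives
     [2 ^- k <= 1 / (k + 1)]. *)
  have [k kI] := ltr_add_invr (divr_gt0 I0 J0).
  have := H k _ mb b01; rewrite -ler_pdivrMr// leNgt => /negP[].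
  apply: le_lt_trans kI; rewrite add0r lef_pV2 ?posrE ?exprn_gt0//.
  by rewrite -natrX ler_nat; exact: ltn_expl.
elim: n c => [|n IH] c mc c01.
  have mcT := Gmeas_measurable mc.
  have cn x : `|c x| <= 1 by rewrite ger0_norm; case/andP: (c01 x).
  rewrite expr0 invr1 mul1r; apply: le_Rintegral => //.
  - exact: integrable_bounded_mul cn ih.
  - exact: integrable_norm.
  move=> x _; apply: le_trans (ler_norm _) _.
  by rewrite normrM ler_piMl.
pose A := c @^-1` `[2^-1, +oo[%classic.
have GA : G A by exact: mc.
have mA : measurable A by exact: (proj2 sG).
pose c' x := 2 * c x - \1_A x.
have gc' : Gmeas G c'.
  apply/GmeasP; apply: measurable_funB.
    by apply: measurable_funM => //; exact/GmeasP.
  by apply: measurable_indic; exact: sub_sigma_algebra.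
have c'01 x : 0 <= c' x <= 1.
  rewrite /c' indicE; have := c01 x.
  have [xA|/negP xA] := boolP (x \in A).
    by move: xA; rewrite inE /A /= in_itv/= andbT => xA; lra.
  have : c x < 2^-1.
    rewrite ltNge; apply/negP => hh; apply: xA.
    by rewrite inE /A/= in_itv/= andbT.
  by move=> h1 h2; rewrite mulr0n; lra.
have mc'T := Gmeas_measurable gc'.
have c'n x : `|c' x| <= 1 by rewrite ger0_norm; case/andP: (c'01 x).
have ic' := integrable_bounded_mul mc'T c'n ih.
have i1 : P.-integrable setT (EFin \o (fun x => \1_A x * h x)).
  apply: (@integrable_bounded_mul _ _ 1) ih => // x.
  by rewrite indicE; case: (x \in A); rewrite ?normr0 ?normr1.
have -> : \int[P]_x (c x * h x) =
    2^-1 * (\int[P]_x (\1_A x * h x) + \int[P]_x (c' x * h x)).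
  rewrite -RintegralD// -RintegralZl//; last exact: (integrableD measurableT i1 ic').
  by apply: eq_Rintegral => x _; rewrite /c'; field.
have -> : \int[P]_x (\1_A x * h x) = \int[P]_(x in A) h x.
  rewrite [RHS]Rintegral_mkcond; apply: eq_Rintegral => x _.
  by rewrite /patch indicE; case: (x \in A); rewrite ?mul1r ?mul0r.
rewrite exprS invfM -mulrA ler_pM2l ?invr_gt0//.
rewrite -[leRHS]add0r; apply: lerD; [exact: hA|exact: IH].
Qed.
End sub_sigma_algebra.

(** * Measurability of the coefficients of the parabola *)

Section measurability_quadratic.
Context {R : realType} {d : measure_display} {T : measurableType d}.
Implicit Types (S M : T -> R).

Lemma measurable_sqpos S :
  measurable_fun setT S -> measurable_fun setT (fun x => sqpos (S x)).
Proof.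
move=> mS; apply: (measurable_funX 2) => //.
by apply: measurable_maxr => //; exact: measurable_cst.
Qed.

(** The conditional mean is nonpositive only almost surely; truncating it at 0 keeps the denominator
    positive everywhere. The inverse is then a nondecreasing function of [M x], hence Borel. *)
Lemma measurable_qinv M (D : R) : 0 < D -> measurable_fun setT M ->
  measurable_fun setT (fun x => (D - Num.min (M x) 0)^-1).
Proof.
move=> D0 mM.
apply: (measurableT_comp (f := fun m : R => (D - Num.min m 0)^-1)) => //.
apply: nondecreasing_measurable => // x y xy.
have h z : Num.min z 0 <= 0 :> R by rewrite ge_min lexx orbT.
have hx := h x; have hy := h y.
rewrite lef_pV2 ?posrE; [|lra..].
by rewrite lerD2l lerN2 le_min !ge_min xy lexx orbT.
Qed.

Lemma measurable_qinv2 M (D v : R) : 0 < D -> 0 < v -> measurable_fun setT M ->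
  measurable_fun setT (fun x => ((D - Num.min (M x) 0) ^+ 2 + v)^-1).
Proof.
move=> D0 v0 mM.
apply: (measurableT_comp (f := fun m : R => ((D - Num.min m 0) ^+ 2 + v)^-1)) => //.
apply: nondecreasing_measurable => // x y xy.
have h z : Num.min z 0 <= 0 :> R by rewrite ge_min lexx orbT.
have hx := h x; have hy := h y.
have le : Num.min x 0 <= Num.min y 0 by rewrite le_min !ge_min xy lexx orbT.
rewrite lef_pV2 ?posrE; [|nra..].
by rewrite lerD2r; nra.
Qed.

Lemma measurable_qcoef M S (D v : R) : 0 < D -> 0 < v ->
  measurable_fun setT M -> measurable_fun setT S ->
  measurable_fun setT (fun x => qcoef D v (Num.min (M x) 0) (S x)).
Proof.
move=> D0 v0 mM mS; apply: (measurable_funX 2) => //.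
apply: measurable_minr; first exact: measurable_cst.
apply: measurable_funM.
  apply: measurable_maxr; first exact: measurable_cst.
  by apply: measurable_funB => //; exact: measurable_cst.
apply: measurable_funM; last exact: measurable_qinv2.
apply: measurable_funB; first exact: measurable_cst.
by apply: measurable_minr => //; exact: measurable_cst.
Qed.

Lemma measurable_qshift M S (D v : R) : 0 < D ->
  measurable_fun setT M -> measurable_fun setT S ->
  measurable_fun setT (fun x => qshift D v (Num.min (M x) 0) (S x)).
Proof.
move=> D0 mM mS; apply: measurable_maxr.
  by apply: measurable_funM; [exact: measurable_cst|exact: measurable_qinv].
apply: measurable_funB => //.
by apply: measurable_minr => //; exact: measurable_cst.
Qed.
End measurability_quadratic.

(** * The one-step bound from conditional first and second moments *)

Section conditional_moments.
Context {R : realType} {d : measure_display} {T : measurableType d}.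
Variable P : probability T R.
Variable G : set (set T).
Hypothesis sG : sub_sigma G.
Variables (S M U : T -> R) (D v u : R).
Hypotheses (D0 : 0 < D) (v0 : 0 < v).
Hypotheses (gS : Gmeas G S) (gM : Gmeas G M).
Hypothesis iU : P.-integrable setT (EFin \o U).
Hypothesis iU2 : P.-integrable setT (EFin \o (fun x => U x ^+ 2 - v)).
Hypothesis UA : forall A, G A -> \int[P]_(x in A) U x <= 0.
Hypothesis U2A : forall A, G A -> \int[P]_(x in A) (U x ^+ 2 - v) <= 0.
Hypothesis M0 : {ae P, forall x, M x <= 0}.
Hypothesis UMD : {ae P, forall x, U x + M x <= D}.

(** The mean of [sqpos (S x + Z + u)] over a centred two-point [Z] with atoms [D] and [- v / D]. *)
Let rho x := v / (D ^+ 2 + v) * sqpos (S x + (u + D)) +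
             D ^+ 2 / (D ^+ 2 + v) * sqpos (S x + (u - v / D)).

Let mS : measurable_fun setT S := Gmeas_measurable sG gS.
Let mM : measurable_fun setT M := Gmeas_measurable sG gM.
Let mU : measurable_fun setT U.
Proof. by apply/measurable_EFinP; case/integrableP : iU. Qed.

Let mrho : measurable_fun setT rho.
Proof.
by apply: measurable_funD; apply: measurable_funM; do ?exact: measurable_cst;
  apply: measurable_sqpos; apply: measurable_funD => //; exact: measurable_cst.
Qed.

Let msq : measurable_fun setT (fun x => sqpos (S x + (U x + M x) + u)).
Proof.
apply: measurable_sqpos; apply: measurable_funD; last exact: measurable_cst.
by apply: measurable_funD => //; exact: measurable_funD.
Qed.

(* The coefficients of the dominating parabola are bounded on [box k], which
   allows pulling them out of the conditional moments. *)
Let box (k : nat) := (fun x => `|S x|) @^-1` `]-oo, k%:R]%classic `&`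
                    (fun x => `|M x|) @^-1` `]-oo, k%:R]%classic.

Let Gbox k : G (box k).
Proof.
rewrite -(measurable_sub_sigma sG); apply: measurableI; rewrite -[X in measurable X]setTI.
- have : measurable_fun [set: g_sigma_algebraType G] (fun x => `|S x|).
    by apply: measurableT_comp => //; exact/(GmeasP sG).
  by apply.
- have : measurable_fun [set: g_sigma_algebraType G] (fun x => `|M x|).
    by apply: measurableT_comp => //; exact/(GmeasP sG).
  by apply.
Qed.

(** The dominating parabola splits as [b (U + c)^2 = b (U^2 - v) + 2 b c U + b (v + c^2)]. The first
    two terms have nonpositive integral by the moment hypotheses, and the last is at most [rho]
    pointwise by [quad_value]. *)
Let box_le k : (\int[P]_(x in box k) (sqpos (S x + (U x + M x) + u))%:E <=
   \int[P]_x (rho x)%:E)%E.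
Proof.
have mA : measurable (box k) by exact: (proj2 sG).
have [D_gt0 v_gt0] := (D0, v0).
pose w x := - (S x + u).
pose c x := qshift D v (Num.min (M x) 0) (w x).
pose b x := qcoef D v (Num.min (M x) 0) (w x) * \1_(box k) x.
have min0 x : Num.min (M x) 0 <= 0 :> R by rewrite ge_min lexx orbT.
have b01 x : 0 <= b x <= 1.
  have /andP[q0 q1] := @qcoef_01 _ _ _ _ (w x) D0 v0 (min0 x).
  by rewrite /b indicE; case: (x \in box k); rewrite ?mulr1 ?mulr0 ?q0 ?q1 ?lexx ?ler01.
(* An upper bound for [c] on the box: [v / D] handles the first branch of [qshift], and the
   remaining terms the second, where [|S x| <= k]. *)
pose K := v / D + 2 * k%:R + `|u| + 1.
have vD0 : 0 < v / D by rewrite divr_gt0.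
have K0 : 0 < K by rewrite /K ltr_wpDl// !addr_ge0// ltW.
have c0 x : 0 <= c x.
  by have h := min0 x; rewrite /c /qshift le_max divr_ge0// ?ltW//; lra.
have cK x : x \in box k -> c x <= K.
  rewrite inE /box /= !in_itv/= => -[Sk Mk].
  have mM' := min0 x; have u0 : 0 <= `|u| by [].
  have k0 : 0 <= k%:R :> R by [].
  rewrite /c /qshift ge_max; apply/andP; split.
    have : v / (D - Num.min (M x) 0) <= v / D.
      by rewrite ler_pM2l// lef_pV2 ?posrE; lra.
    rewrite /K; lra.
  have := ler_norm u; have := ler_norm (S x); rewrite /w /K; lra.
have bc x : 0 <= b x * c x <= K.
  rewrite mulr_ge0//=; last by case/andP: (b01 x).
  have [xA|xA] := boolP (x \in box k); last first.
    by rewrite /b indicE (negbTE xA) mulr0 mul0r ltW.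
  have /andP[b0 b1] := b01 x.
  by apply: (@le_trans _ _ (c x)); [rewrite ler_piMl|exact: cK].
have gw : measurable_fun [set: g_sigma_algebraType G] w.
  apply: measurableT_comp => //; apply: measurable_funD; last exact: measurable_cst.
  exact/(GmeasP sG).
have gb' : measurable_fun [set: g_sigma_algebraType G] b.
  apply: measurable_funM; first by apply: measurable_qcoef => //; exact/(GmeasP sG).
  by apply: measurable_indic; apply: sub_sigma_algebra; exact: Gbox.
have gc' : measurable_fun [set: g_sigma_algebraType G] c.
  by apply: measurable_qshift => //; exact/(GmeasP sG).
have gb : Gmeas G b by exact/(GmeasP sG).
(* The weight [b c] of the linear term, rescaled into [0, 1] so that [integral_Gmeas_mul_le0]
   applies; [h1] multiplies by [K] again. *)
pose e x := K^-1 * (b x * c x).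
have ge : Gmeas G e.
  apply/(GmeasP sG); apply: measurable_funM; first exact: measurable_cst.
  exact: measurable_funM.
have e01 x : 0 <= e x <= 1.
  have /andP[h1 h2] := bc x.
  apply/andP; split; last by rewrite /e ler_pdivrMl// mulr1.
  by apply: mulr_ge0 => //; rewrite invr_ge0 ltW.
have mb := Gmeas_measurable sG gb; have me := Gmeas_measurable sG ge.
have mc : measurable_fun setT c by apply: (Gmeas_measurable sG); exact/(GmeasP sG).
have bn x : `|b x| <= 1 by rewrite ger0_norm; case/andP: (b01 x).
have en x : `|e x| <= 1 by rewrite ger0_norm; case/andP: (e01 x).
have I1 := integrable_bounded_mul mb bn iU2.
have I2 := integrable_bounded_mul me en iU.
pose h1 x := b x * (U x ^+ 2 - v) + 2 * K * (e x * U x).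
have I2' : P.-integrable setT (EFin \o (fun x => 2 * K * (e x * U x))).
  rewrite (_ : EFin \o _ = (fun x => (2 * K)%:E * (e x * U x)%:E)%E)//.
  exact: integrableZl.
have I3 : P.-integrable setT (EFin \o h1) by exact: (integrableD measurableT I1 I2').
have h10 : (\int[P]_x (h1 x)%:E <= 0)%E.
  rewrite -[leLHS]fineK; last exact: (integrable_fin_num _ I3).
  rewrite lee_fin -/(Rintegral _ _ _) RintegralD// RintegralZl//.
  rewrite -[leRHS]addr0 lerD//; first exact: (integral_Gmeas_mul_le0 sG).
  by rewrite mulr_ge0_le0//; [lra|exact: (integral_Gmeas_mul_le0 sG)].
pose h2 x := b x * (v + c x ^+ 2).
have mh2 : measurable_fun setT h2.
  apply: measurable_funM => //; apply: measurable_funD; first exact: measurable_cst.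
  exact: measurable_funX.
have h20 x : 0 <= h2 x.
  have /andP[B0 _] := b01 x.
  by apply: mulr_ge0 => //; apply: addr_ge0; [exact: ltW|exact: sqr_ge0].
have h2r x : h2 x <= rho x.
  have := @quad_value _ _ _ _ (w x) D0 v0 (min0 x).
  have -> : D - w x = S x + (u + D) by rewrite /w; ring.
  have -> : - (v / D) - w x = S x + (u - v / D) by rewrite /w; ring.
  move=> H; apply: le_trans H; rewrite /h2 ler_wpM2r//.
    by rewrite addr_ge0 ?sqr_ge0// ltW.
  have /andP[q0 q1] := @qcoef_01 _ _ _ _ (w x) D0 v0 (min0 x).
  by rewrite /b indicE; case: (x \in box k); rewrite ?mulr1 ?mulr0 ?q0.
have I4 : P.-integrable setT (EFin \o h2).
  have bd x : `|h2 x| <= v + K ^+ 2.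
    rewrite ger0_norm// /h2 mulrDr.
    have /andP[B0 B1] := b01 x.
    have [xA|xA] := boolP (x \in box k); last first.
      by rewrite /b indicE (negbTE xA) mulr0 !mul0r addr0 addr_ge0 ?sqr_ge0// ltW.
    rewrite lerD//; first by rewrite ler_piMl// ltW.
    apply: (@le_trans _ _ (c x ^+ 2)); first by rewrite ler_piMl ?sqr_ge0.
    by rewrite lerXn2r ?nnegrE ?cK// ltW.
  have := integrable_bounded_mul mh2 bd (finite_measure_integrable_cst P 1 measurableT).
  by congr (integrable _ _ _); apply/funext => x /=; rewrite mulr1.
apply: (@le_trans _ _ (\int[P]_x (h1 x + h2 x)%:E)%E); last first.
  rewrite (integralD_EFin measurableT I3 I4) -[leRHS]add0e leeD//.
  apply: ge0_le_integral => //.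
  - by move=> x _; rewrite lee_fin.
  - exact/measurable_EFinP.
  - exact/measurable_EFinP.
  - by move=> x _; rewrite lee_fin.
have h12 x : h1 x + h2 x = b x * (U x + c x) ^+ 2.
  rewrite /h1 /h2 /e; field.
  by rewrite gt_eqF.
rewrite integral_mkcond; apply: ae_ge0_le_integral => //.
- by move=> x _; rewrite /patch; case: ifP => // _; rewrite lee_fin sqpos_ge0.
- by apply/(measurable_restrictT _ mA); apply: measurable_funTS; exact/measurable_EFinP.
- move=> x _; have /andP[B0 _] := b01 x; rewrite lee_fin h12.
  by apply: mulr_ge0 => //; exact: sqr_ge0.
- apply/measurable_EFinP; apply: measurable_funD => //.
  by case/integrableP: I3 => /measurable_EFinP.
(* Off the box the left integrand is 0 and the right one a nonnegative multiple of a square; on the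
   box [M x <= 0] makes the truncation of [M] inactive and [quad_dominates] applies. *)
apply: filterS2 M0 UMD => x Mx UMx _; rewrite h12 /patch.
case: ifP => xA; rewrite lee_fin; last first.
  by have /andP[B0 _] := b01 x; apply: mulr_ge0 => //; exact: sqr_ge0.
have := @quad_dominates _ _ _ _ (w x) _ D0 v0 Mx UMx.
have -> : S x + (U x + M x) + u = U x + M x - w x by rewrite /w; ring.
by rewrite /b /c indicE xA mulr1 min_l.
Qed.

(** Monotone convergence along the boxes, which increase to the whole space. *)
Lemma sqpos_le_cond_moments : (\int[P]_x (sqpos (S x + (U x + M x) + u))%:E <=
   \int[P]_x (rho x)%:E)%E.
Proof.
have mA k : measurable (box k) by exact: (proj2 sG).
have bT : \bigcup_k box k = setT.
  apply/seteqP; split => // x _.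
  pose y := `|S x| + `|M x|.
  exists (Num.bound y) => //=; rewrite /box /= !in_itv/=.
  have y0 : 0 <= y by apply: addr_ge0.
  have := archi_boundP y0.
  have : 0 <= `|S x| by []. have : 0 <= `|M x| by []. rewrite /y; lra.
have nd : nondecreasing_seq box.
  move=> i j ij; rewrite subsetEset => x; rewrite /box /= !in_itv/= => -[h1 h2].
  have ij' : i%:R <= j%:R :> R by rewrite ler_nat.
  by split; exact: le_trans ij'.
have := @ge0_nondecreasing_set_cvg_integral _ _ _ box
  (fun x => (sqpos (S x + (U x + M x) + u))%:E) P nd mA.
rewrite bT => H; apply: (cvge_to_le (H _ _)).
- by move=> k; apply: measurable_funTS; exact/measurable_EFinP.
- by move=> k x _; rewrite lee_fin sqpos_ge0.
by apply: nearW => k; exact: box_le.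
Qed.
End conditional_moments.

Lemma ge0_integral_comb d (T : measurableType d) (R : realType)
    (mu : {measure set T -> \bar R}) (f g : T -> R) (a b : R) :
  measurable_fun setT f -> measurable_fun setT g ->
  (forall x, 0 <= f x) -> (forall x, 0 <= g x) -> 0 <= a -> 0 <= b ->
  (\int[mu]_x (a * f x + b * g x)%:E =
   a%:E * \int[mu]_x (f x)%:E + b%:E * \int[mu]_x (g x)%:E)%E.
Proof.
move=> mf mg f0 g0 a0 b0.
have aux (h : T -> R) (c : R) : measurable_fun setT h -> (forall x, 0 <= h x) -> 0 <= c ->
    (c%:E * \int[mu]_x (h x)%:E = \int[mu]_x (c * h x)%:E)%E.
  move=> mh h0 c0; rewrite -ge0_integralZl_EFin//.
  - by move=> x _; rewrite lee_fin.
  - exact/measurable_EFinP.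
rewrite !aux// -ge0_integralD//.
- by move=> x _; rewrite lee_fin mulr_ge0.
- by apply/measurable_EFinP; apply: measurable_funM => //; exact: measurable_cst.
- by move=> x _; rewrite lee_fin mulr_ge0.
- by apply/measurable_EFinP; apply: measurable_funM => //; exact: measurable_cst.
Qed.

(** * One step of the supermartingale *)

Section supermartingale_step.
Context {R : realType} {d : measure_display} {T : measurableType d}.
Variable P : probability T R.
Variable G : set (set T).
Hypothesis sG : sub_sigma G.

(** The set where [M > 0] belongs to [G], and the integral of [M] over it equals that of [Y - S],
    which is nonpositive. So [M] vanishes almost everywhere on a set where it is positive, and that
    set is null. *)
Lemma cond_exp_increment_le0 (S S' M Y : T -> R) :
  Gmeas G S -> P.-integrable setT (EFin \o S) -> P.-integrable setT (EFin \o S') ->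
  is_cond_exp P G (fun x => S' x - S x) M ->
  is_cond_exp P G S' Y -> {ae P, forall x, Y x <= S x} ->
  {ae P, forall x, M x <= 0}.
Proof.
move=> gS iS iS' [gM [iM eM]] [gY [iY eY]] YS.
pose A := M @^-1` `]0, +oo[%classic.
have GA : G A by exact: gM.
have mA : measurable A by exact: (proj2 sG).
have sub (f : T -> R) : P.-integrable setT (EFin \o f) -> P.-integrable A (EFin \o f).
  by move=> h; apply: integrableS h.
have mS := Gmeas_measurable sG gS; have mM := Gmeas_measurable sG gM.
have mY := Gmeas_measurable sG gY.
have M0 x : A x -> 0 < M x by rewrite /A /= in_itv/= andbT.
have I0 : (\int[P]_(x in A) (M x)%:E <= 0)%E.
  rewrite eM//.
  rewrite (_ : \int[P]_(x in A) (S' x - S x)%:E =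
    \int[P]_(x in A) ((EFin \o S') \- (EFin \o S)) x)%E//.
  rewrite integralB_EFin; [|by []|exact: sub|exact: sub].
  rewrite -eY// -integralB_EFin; [|by []|exact: sub|exact: sub].
  (* Replacing [Y - S] by an almost everywhere equal function that is nonpositive at every point
     makes its positive part vanish identically. *)
  rewrite (ae_eq_integral (fun x => (Num.min (Y x - S x) 0)%:E))//.
  - rewrite integralE [X in (X - _)%E]integral0_eq; last first.
      by move=> x _; rewrite funeposE max_r// lee_fin ge_min lexx orbT.
    by rewrite sub0e oppe_le0; apply: integral_ge0.
  - by apply: measurable_funTS; apply/measurable_EFinP; exact: measurable_funB.
  - apply: measurable_funTS; apply/measurable_EFinP.
    by apply: measurable_minr; [exact: measurable_funB|exact: measurable_cst].
  - by apply: filterS YS => x YSx _ /=; rewrite min_l// subr_le0.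
have /(ae_eq_integral_abs P mA) : (\int[P]_(x in A) `|(M x)%:E| = 0)%E.
  apply/eqP; rewrite eq_le; apply/andP; split; last by apply: integral_ge0.
  rewrite (eq_integral (fun x => (M x)%:E))// => x; rewrite inE => /M0 h.
  by rewrite gee0_abs// lee_fin ltW.
have mME : measurable_fun A (fun x => (M x)%:E).
  by apply: measurable_funTS; exact/measurable_EFinP.
move=> /(_ mME); apply: filterS => x h; rewrite leNgt; apply/negP => Mx.
have xA : A x by rewrite /A /= in_itv/= andbT.
by have [M00] := h xA; rewrite M00 ltxx in Mx.
Qed.

Lemma sqpos_supermartingale_step (S S' Y : T -> R) (D v u : R) : 0 < D -> 0 < v ->
  Gmeas G S -> P.-integrable setT (EFin \o S) -> P.-integrable setT (EFin \o S') ->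
  is_cond_exp P G S' Y -> {ae P, forall x, Y x <= S x} ->
  {ae P, forall x, S' x - S x <= D} ->
  cond_var_le P G (fun x => S' x - S x) v ->
  (\int[P]_x (sqpos (S' x + u))%:E <=
    (v / (D ^+ 2 + v))%:E * \int[P]_x (sqpos (S x + (u + D)))%:E +
    (D ^+ 2 / (D ^+ 2 + v))%:E * \int[P]_x (sqpos (S x + (u - v / D)))%:E)%E.
Proof.
move=> D0 v0 gS iS iS' cY YS XD [M [cM [V [[gV [V0 eV]] Vv]]]].
have M0 := cond_exp_increment_le0 gS iS iS' cM cY YS.
have [gM [iM eM]] := cM.
have mS := Gmeas_measurable sG gS; have mM := Gmeas_measurable sG gM.
pose X x := S' x - S x; pose U x := X x - M x.
have iX : P.-integrable setT (EFin \o X) by exact: (integrableB measurableT iS' iS).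
have iU : P.-integrable setT (EFin \o U) by exact: (integrableB measurableT iX iM).
have mU : measurable_fun setT U by apply/measurable_EFinP; case/integrableP : iU.
have mV : measurable_fun setT V.
  by move=> _ B mB; rewrite setTI; exact/(proj2 sG)/gV.
have UA A : G A -> \int[P]_(x in A) U x <= 0.
  move=> GA; have mA : measurable A by exact: (proj2 sG).
  rewrite RintegralB//; [|by apply: integrableS iX|by apply: integrableS iM].
  by rewrite /Rintegral eM// subrr.
(* Stated in extended reals because square integrability of [U] is not yet known; it follows below
   from the case of the whole space. *)
have WA A : G A -> (\int[P]_(x in A) (U x ^+ 2)%:E <= v%:E * P A)%E.
  move=> GA; have mA : measurable A by exact: (proj2 sG).
  rewrite -eV// -integral_cst//; apply: ae_ge0_le_integral => //.
  - exact: measurable_funTS.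
  - by move=> x _; rewrite /cst lee_fin ltW.
  - by apply: filterS Vv => x h _.
have iW : P.-integrable setT (EFin \o (fun x => U x ^+ 2)).
  apply/integrableP; split; first by apply/measurable_EFinP; exact: measurable_funX.
  rewrite (eq_integral (fun x => (U x ^+ 2)%:E)); last first.
    by move=> x _ /=; rewrite ger0_norm ?sqr_ge0.
  have GT : G setT by have [[G0 GC _] _] := sG; rewrite -(setD0 setT); exact: GC.
  by apply: le_lt_trans (WA _ GT) _; rewrite probability_setT mule1 ltry.
have iv : P.-integrable setT (EFin \o cst v).
  exact: finite_measure_integrable_cst.
have iU2 : P.-integrable setT (EFin \o (fun x => U x ^+ 2 - v)).
  exact: (integrableB measurableT iW iv).
have U2A A : G A -> \int[P]_(x in A) (U x ^+ 2 - v) <= 0.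
  move=> GA; have mA : measurable A by exact: (proj2 sG).
  rewrite RintegralB//; [|by apply: integrableS iW|by apply: integrableS iv].
  rewrite Rintegral_cst// subr_le0 -lee_fin fineK; last first.
    by apply: integrable_fin_num => //; apply: integrableS iW.
  rewrite EFinM fineK; first exact: WA.
  exact: fin_num_measure.
have XD' : {ae P, forall x, U x + M x <= D}.
  by apply: filterS XD => x; rewrite /U /X subrK.
have := sqpos_le_cond_moments sG u D0 v0 gS gM iU iU2 UA U2A M0 XD'.
have mq s : measurable_fun setT (fun x => sqpos (S x + s)).
  by apply: measurable_sqpos; apply: measurable_funD => //; exact: measurable_cst.
have p0 : 0 < D ^+ 2 + v by rewrite addr_gt0// exprn_gt0.
rewrite ge0_integral_comb//; do ?[by move=> x; exact: sqpos_ge0]; last 2 first.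
- by rewrite divr_ge0// ltW.
- by rewrite divr_ge0 ?sqr_ge0// ltW.
apply: le_trans; rewrite le_eqVlt; apply/orP; left; apply/eqP.
by apply: eq_integral => x _; congr (sqpos _)%:E; rewrite /U /X; ring.
Qed.
End supermartingale_step.

(** * Iterated two-point averages *)

Section two_point.
Context {R : realType}.
Variables dd sig : nat -> R.

(* [true] stands for the upper atom. *)
Definition tp_val i (b : bool) : R := if b then dd i else - (sig i ^+ 2 / dd i).
Definition tp_prob i (b : bool) : R :=
  (if b then sig i ^+ 2 else dd i ^+ 2) / (dd i ^+ 2 + sig i ^+ 2).

(** This is the mean of [f (u + Z_1 + ... + Z_k)], computed without a probability space. The
    outermost average is over the last variable, matching a supermartingale conditioned one step
    before its final time. *)
Fixpoint tp_avg k (f : R -> R) (u : R) : R :=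
  if k is k'.+1 then
    tp_prob k true * tp_avg k' f (u + tp_val k true) +
    tp_prob k false * tp_avg k' f (u + tp_val k false)
  else f u.

Lemma tp_prob_ge0 i b : 0 <= tp_prob i b.
Proof. by rewrite divr_ge0 ?addr_ge0 ?sqr_ge0//; case: b; exact: sqr_ge0. Qed.

Lemma tp_avg_ge0 k f u : (forall x, 0 <= f x) -> 0 <= tp_avg k f u.
Proof.
move=> f0; elim: k u => [//|k IH] u /=.
by apply: addr_ge0; apply: mulr_ge0; do ?exact: IH; exact: tp_prob_ge0.
Qed.

Lemma measurable_tp_avg k u :
  measurable_fun setT (fun t : R => tp_avg k (fun z => sqpos (z - t)) u).
Proof.
elim: k u => [|k IH] u /=.
  by apply: measurable_sqpos; apply: measurable_funB; [exact: measurable_cst|].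
by apply: measurable_funD; apply: measurable_funM; do ?exact: IH; exact: measurable_cst.
Qed.

Lemma tp_avg_F2 (mu : {measure set R -> \bar R}) f k u :
  (forall u, (f u)%:E = \int[mu]_t (sqpos (u - t))%:E)%E ->
  ((tp_avg k f u)%:E = \int[mu]_t (tp_avg k (fun z => sqpos (z - t)) u)%:E)%E.
Proof.
move=> fE; elim: k u => [//|k IH] u /=.
rewrite EFinD !EFinM !IH ge0_integral_comb//; do ?exact: measurable_tp_avg;
  do ?exact: tp_prob_ge0.
- by move=> t; apply: tp_avg_ge0 => x; exact: sqpos_ge0.
- by move=> t; apply: tp_avg_ge0 => x; exact: sqpos_ge0.
Qed.
End two_point.

(** * Tonelli for the measure that represents [f] *)

Section sigma_finite_tonelli.
Context d d' (T : measurableType d) (T' : measurableType d') (R : realType).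
Variables (P : probability T R) (mu : {measure set T' -> \bar R}).
Hypothesis sf : sigma_finite setT mu.

(** An alias of [mu] on which the hypothesis [sf] can be registered as a sigma-finite structure. *)
Let nu : set T' -> \bar R := mu.
HB.instance Definition _ := Measure.on nu.
HB.instance Definition _ := @Measure_isSigmaFinite.Build _ _ _ nu sf.

Lemma sigma_finite_tonelli (h : T * T' -> \bar R) :
  measurable_fun setT h -> (forall z, 0 <= h z)%E ->
  (\int[P]_x \int[mu]_y h (x, y) = \int[mu]_y \int[P]_x h (x, y))%E.
Proof. exact: (@fubini_tonelli _ _ _ _ _ P nu). Qed.
End sigma_finite_tonelli.

Section F2.
Context {R : realType}.
Variables (mu : {measure set R -> \bar R}) (f : R -> R).
Hypothesis fE : (forall u, (f u)%:E = \int[mu]_t (sqpos (u - t))%:E)%E.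

Let msq u : measurable_fun setT (fun t : R => (sqpos (u - t))%:E).
Proof.
apply/measurable_EFinP; apply: measurable_sqpos.
by apply: measurable_funB; [exact: measurable_cst|].
Qed.

Lemma F2_ge0 u : 0 <= f u.
Proof. by rewrite -lee_fin fE integral_ge0// => x _; rewrite lee_fin sqpos_ge0. Qed.

Lemma F2_measurable : measurable_fun setT f.
Proof.
apply: nondecreasing_measurable => // x y xy.
rewrite -lee_fin !fE; apply: ge0_le_integral => //.
- by move=> t _; rewrite lee_fin sqpos_ge0.
- move=> t _; rewrite lee_fin {2}/sqpos.
  apply: sqpos_le; first by rewrite le_max lexx.
  by rewrite le_max lerD2r xy orbT.
Qed.

(** Finiteness of [f] forces this: for [t <= k] the kernel [(k + 1 - t)_+^2] is at least 1, so the
    half-line up to [k] has measure at most [f (k + 1)]. *)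
Lemma F2_sigma_finite : sigma_finite setT mu.
Proof.
exists (fun k : nat => `]-oo, k%:R]%classic : set R).
  apply/seteqP; split => // x _; exists (Num.bound x) => //=.
  rewrite in_itv/=; have [x0|/ltW x0] := leP 0 x; last exact: le_trans x0 _.
  by rewrite ltW// archi_boundP.
move=> k; split; first exact: measurable_itv.
apply: (@le_lt_trans _ _ (f (k%:R + 1))%:E); last exact: ltry.
rewrite fE -[X in (X <= _)%E]mul1e -integral_cst; last exact: measurable_itv.
rewrite integral_mkcond; apply: ge0_le_integral => //.
- by move=> t _; rewrite /patch; case: ifP => //= _; rewrite lee_fin.
- by apply/(measurable_restrictT _ (measurable_itv _)).
- move=> t _; rewrite /patch; case: ifP => //=; last by rewrite lee_fin sqpos_ge0.
  rewrite inE /= in_itv/= => tk; rewrite lee_fin sqpos_pos; last lra.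
  nra.
Qed.

Lemma F2_tonelli d (T : measurableType d) (P : probability T R) (X : T -> R) :
  measurable_fun setT X ->
  (\int[P]_x (f (X x))%:E = \int[mu]_t \int[P]_x (sqpos (X x - t))%:E)%E.
Proof.
move=> mX.
under eq_integral do rewrite fE.
apply: (@sigma_finite_tonelli _ _ _ _ _ P mu F2_sigma_finite
  (fun z => (sqpos (X z.1 - z.2))%:E)).
- apply/measurable_EFinP; apply: measurable_sqpos; apply: measurable_funB => //.
  exact: measurableT_comp.
- by move=> z; rewrite lee_fin sqpos_ge0.
Qed.
End F2.

(** * The lower bound for the sum of the independent variables *)

Section independent_sum.
Context {R : realType} {d : measure_display} {T : measurableType d}.
Variable Q : probability T R.
Variables (n : nat) (Z : nat -> T -> R) (dd sig : nat -> R) (f : R -> R).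
Hypothesis pos : forall i, (0 < i)%N -> 0 < dd i /\ 0 < sig i.
Hypothesis mZ : forall i, (1 <= i <= n)%N -> measurable_fun setT (Z i).
Hypothesis iZ : indep_family Q n Z.
Hypothesis QZ : forall i b, (1 <= i <= n)%N ->
  Q (Z i @^-1` [set tp_val dd sig i b]) = (tp_prob dd sig i b)%:E.
Hypotheses (f0 : forall u, 0 <= f u) (mf : measurable_fun setT f).

Let cyl k (c : nat -> bool) : set T :=
  \bigcap_(i in [set i | (k < i <= n)%N]) Z i @^-1` [set tp_val dd sig i (c i)].

Let mcyl k c : measurable (cyl k c).
Proof.
apply: bigcap_measurableType => i /= /andP[ki ni].
by rewrite -[X in measurable X]setTI; apply: mZ => //; rewrite ni (leq_trans _ ki).
Qed.

Let g w := (f (\sum_(1 <= i < n.+1) Z i w))%:E.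

Let mg : measurable_fun setT g.
Proof.
apply/measurable_EFinP; apply: measurableT_comp => //.
rewrite (_ : (fun w => _) = (fun w => \sum_(i < n) Z i.+1 w)); last first.
  by apply/funext => w; rewrite big_add1 big_mkord.
by apply: measurable_sum => i; apply: mZ; rewrite /= ltn_ord.
Qed.

Let g0 w : (0 <= g w)%E. Proof. by rewrite lee_fin. Qed.

(** For [k = 0] all variables are frozen: [f] of the sum is constant on the cylinder, whose mass is
    a product by independence. Releasing [Z_{k+1}] keeps at least the two disjoint subcylinders
    given by its atoms, and [f >= 0] makes the integral no smaller than the sum over them. *)
Lemma tp_avg_cyl k c : (k <= n)%N ->
  (((\prod_(k.+1 <= i < n.+1) tp_prob dd sig i (c i)) *
    tp_avg dd sig k f (\sum_(k.+1 <= i < n.+1) tp_val dd sig i (c i)))%:E <=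
   \int[Q]_(w in cyl k c) g w)%E.
Proof.
elim: k c => [|k IH] c kn.
  rewrite (eq_integral
    (cst (f (\sum_(1 <= i < n.+1) tp_val dd sig i (c i)))%:E)); last first.
    move=> w; rewrite inE => cw; rewrite /g; congr (f _)%:E.
    by apply: eq_big_nat => i; exact: cw.
  suff QE : Q (cyl 0%N c) = (\prod_(1 <= i < n.+1) tp_prob dd sig i (c i))%:E.
    by rewrite integral_cst// mulrC EFinM -QE.
  rewrite /cyl (iZ (fun i => measurable_set1 (tp_val dd sig i (c i)))).
  rewrite (big_morph EFin EFinM erefl); apply: eq_big_nat => i ni.
  exact: QZ.
pose c' b i := if i == k.+1 then b else c i.
have E b : (\prod_(k.+2 <= i < n.+1) tp_prob dd sig i (c' b i) =
            \prod_(k.+2 <= i < n.+1) tp_prob dd sig i (c i)) /\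
     (\sum_(k.+2 <= i < n.+1) tp_val dd sig i (c' b i) =
      \sum_(k.+2 <= i < n.+1) tp_val dd sig i (c i)).
  by split; apply: eq_big_nat => i /andP[ki _]; rewrite /c' gtn_eqF.
have sub b : cyl k (c' b) `<=` cyl k.+1 c.
  move=> w cw i /= /andP[ki ni]; have := cw i; rewrite /= ni (ltnW ki) => /(_ isT).
  by rewrite /c' gtn_eqF.
(* The two atoms of [Z_{k+1}] have opposite signs, hence differ. *)
have dis : [disjoint cyl k (c' true) & cyl k (c' false)].
  apply/disj_setPS => w [h1 h2].
  have := h1 k.+1; have := h2 k.+1; rewrite /= ltnSn kn => /(_ isT) + /(_ isT).
  rewrite /c' eqxx /tp_val => -> h.
  have [D0 s0] := pos (ltn0Sn k).
  have : 0 < sig k.+1 ^+ 2 / dd k.+1 by rewrite divr_gt0// exprn_gt0.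
  by lra.
apply: (@le_trans _ _
  (\int[Q]_(w in cyl k (c' true) `|` cyl k (c' false)) g w)%E); last first.
  apply: ge0_subset_integral => //; [exact: measurableU|exact: measurable_funTS|].
  by move=> w [|]; exact: sub.
rewrite ge0_integral_setU//; last exact: measurable_funTS.
apply: le_trans (leeD (IH (c' true) (ltnW kn)) (IH (c' false) (ltnW kn))).
have [P1 S1] := E true; have [P2 S2] := E false.
rewrite -EFinD lee_fin !(big_ltn (m := k.+1))// P1 P2 S1 S2 /= /c' eqxx.
set p := \prod_(_ <= _ < _) _; set s := \sum_(_ <= _ < _) _.
by rewrite !(addrC s) le_eqVlt; apply/orP; left; apply/eqP; ring.
Qed.

Lemma tp_avg_le_integral : ((tp_avg dd sig n f 0)%:E <= \int[Q]_w g w)%E.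
Proof.
have := tp_avg_cyl (fun=> true) (leqnn n).
rewrite !big_geq// mul1r (_ : cyl n _ = setT)//.
by apply/seteqP; split => // w _ i /= /andP[h1 h2]; move: (leq_trans h1 h2); rewrite ltnn.
Qed.
End independent_sum.

(** * Induction along the supermartingale *)

Section supermartingale_bound.
Context {R : realType} {d : measure_display} {T : measurableType d}.
Variables (P : probability T R) (H : nat -> set (set T)) (S : nat -> T -> R).
Variables dd sig : nat -> R.
Hypothesis sup : supermartingale P H S.
Hypothesis S0 : {ae P, forall x, S 0%N x <= 0}.
Hypothesis pos : forall i, (0 < i)%N -> 0 < dd i /\ 0 < sig i.
Hypothesis Xd : forall i, (0 < i)%N -> {ae P, forall x, S i x - S i.-1 x <= dd i}.
Hypothesis Xv : forall i, (0 < i)%N ->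
  cond_var_le P (H i.-1) (fun x => S i x - S i.-1 x) (sig i ^+ 2).

(** Induction on [k], peeling off the last increment with the one-step bound. The shift [u] is
    general because each step moves it by an atom; the base case is monotonicity of [sqpos] together
    with [S 0 <= 0]. *)
Lemma supermartingale_sqpos k t u :
  (\int[P]_x (sqpos (S k x + (u - t)))%:E <=
   (tp_avg dd sig k (fun z => sqpos (z - t)) u)%:E)%E.
Proof.
have [[sH _] [gS [iS cS]]] := sup.
elim: k u => [|k IH] u /=.
  rewrite -[leRHS]mule1 -(@probability_setT _ _ _ P) -integral_cst//.
  apply: ae_ge0_le_integral => //.
  - by move=> x _; rewrite lee_fin sqpos_ge0.
  - apply/measurable_EFinP/measurable_sqpos/measurable_funD; last exact: measurable_cst.
    exact (Gmeas_measurable (sH 0%N) (gS 0%N)).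
  - by move=> x _; rewrite lee_fin sqpos_ge0.
  - apply: filterS S0 => x Sx _; rewrite lee_fin {2}/sqpos.
    by apply: sqpos_le; rewrite le_max ?lexx//; apply/orP; right; lra.
have [D0 s0] := pos (ltn0Sn k).
have [Y [cY YS]] := cS k.
have v0 : 0 < sig k.+1 ^+ 2 by rewrite exprn_gt0.
have := sqpos_supermartingale_step (sH k) (u - t) D0 v0 (gS k) (iS k) (iS k.+1) cY YS
  (Xd (ltn0Sn k)) (Xv (ltn0Sn k)).
move=> /le_trans; apply; rewrite EFinD !EFinM /tp_prob; apply: leeD.
- apply: lee_wpmul2l; first by rewrite lee_fin; exact: (tp_prob_ge0 dd sig k.+1 true).
  rewrite (_ : u - t + dd k.+1 = u + tp_val dd sig k.+1 true - t); first exact: IH.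
  by rewrite /tp_val addrAC.
- apply: lee_wpmul2l; first by rewrite lee_fin; exact: (tp_prob_ge0 dd sig k.+1 false).
  rewrite (_ : u - t - _ = u + tp_val dd sig k.+1 false - t); first exact: IH.
  by rewrite /tp_val addrAC.
Qed.
End supermartingale_bound.

(** * The comparison for all functions of the class *)

Local Open Scope ereal_scope.

Theorem theorem2p1 (R : realType) (d : measure_display) (T : measurableType d)
  (P : probability T R) (H : nat -> set (set T)) (S : nat -> T -> R)
  (dd sig : nat -> R) :
  supermartingale P H S ->
  {ae P, forall x, (S 0%N x <= 0)%R} ->
  (forall i, (0 < i)%N -> (0 < dd i)%R /\ (0 < sig i)%R) ->
  (forall i, (0 < i)%N -> {ae P, forall x, (S i x - S i.-1 x <= dd i)%R}) ->
  (forall i, (0 < i)%N ->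
     cond_var_le P (H i.-1) (fun x => S i x - S i.-1 x)%R (sig i ^+ 2)%R) ->
  forall n : nat, (0 < n)%N ->
  forall (d' : measure_display) (Om : measurableType d') (Q : probability Om R)
         (Z : nat -> Om -> R),
    (forall i, (1 <= i <= n)%N -> measurable_fun setT (Z i)) ->
    indep_family Q n Z ->
    (forall i, (1 <= i <= n)%N ->
       Q (Z i @^-1` [set dd i]) =
         ((sig i ^+ 2 / (dd i ^+ 2 + sig i ^+ 2))%R)%:E /\
       Q (Z i @^-1` [set (- (sig i ^+ 2 / dd i))%R]) =
         ((dd i ^+ 2 / (dd i ^+ 2 + sig i ^+ 2))%R)%:E) ->
    forall f : R -> R, F2plus f ->
      \int[P]_x (f (S n x))%:E <=
      \int[Q]_w (f (\sum_(1 <= i < n.+1) Z i w)%R)%:E.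
Proof.
move=> sup S0 pos Xd Xv n n0 d' Om Q Z mZ iZ QZ f [mu fE].
have mS : measurable_fun setT (S n).
  by have [[sH _] [gS _]] := sup; exact (Gmeas_measurable (sH n) (gS n)).
apply: (@le_trans _ _ (tp_avg dd sig n f 0)%:E); last first.
  apply: (@tp_avg_le_integral _ _ _ Q n Z dd sig) => //.
  - by move=> i b ni; have [Qt Qf] := QZ i ni; case: b.
  - exact: (F2_ge0 fE).
  - exact: (F2_measurable fE).
(* Both sides become integrals against [mu], so it is enough to compare the integrands for each
   fixed [t]. *)
rewrite (F2_tonelli fE)// (tp_avg_F2 _ _ _ _ fE).
apply: ge0_le_integral => //.
- by move=> t _; apply: integral_ge0 => x _; rewrite lee_fin sqpos_ge0.
- apply: (@measurable_fun_fubini_tonelli_G _ _ _ _ _ P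
    (fun z : T * R => (sqpos (S n z.1 - z.2))%:E)); last first.
    by move=> z; rewrite lee_fin sqpos_ge0.
  apply/measurable_EFinP; apply: measurable_sqpos; apply: measurable_funB => //.
  exact: measurableT_comp.
- by apply/measurable_EFinP; exact: measurable_tp_avg.
move=> t _; have := supermartingale_sqpos sup S0 pos Xd Xv n t 0.
by under eq_integral do rewrite sub0r.
Qed.
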